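(* Let $T\colon C_\infty[0,\infty)\to C_\infty[0,\infty)$ be the Cesàro operator. (a) Let $f\in C_\infty[0,\infty)$. The following are equivalent: (i) $f(0)=\lim_{t\to\infty}f(t)$; (ii) $(T^nf)_{n\ge0}$ converges weakly in $C_\infty[0,\infty)$ as $n\to\infty$; (iii) $(T^nf)_{n\ge0}$ converges in norm in $C_\infty[0,\infty)$ as $n\to\infty$. Furthermore, if these conditions hold then $\|T^nf-Pf\|_\infty\to0$ as $n\to\infty$. (b) If $f\in C_\infty[0,\infty)$ is such that $f(0)=\lim_{t\to\infty}f(t)$ and the improper Riemann integral $\int_0^\infty\frac{f(t)-f(0)}{t}\,\mathrm{d}t$ exists, then $\|T^nf-Pf\|_\infty=O(n^{-1/2})$ as $n\to\infty$.
   Context: $C_\infty[0,\infty)$ denotes the complex Banach space of continuous functions $f\colon[0,\infty)\to\mathbb{C}$ such that $\lim_{t\to\infty}f(t)$ exists in $\mathbb{C}$, endowed with the supremum norm $\|\cdot\|_\infty$. The Cesàro operator $T$ on $C_\infty[0,\infty)$ is the bounded linear operator defined by $(Tf)(0)=f(0)$ and $(Tf)(t)=\frac1t\int_0^tf(s)\,\mathrm{d}s$ for $t>0$. The operator $P\colon C_\infty[0,\infty)\to C_\infty[0,\infty)$ is defined by $(Pf)(t)=f(0)$ for all $t\ge0$. The improper Riemann integral over $(0,\infty)$ is improper at both endpoints: it exists if both $\lim_{\varepsilon\to0+}\int_\varepsilon^1$ and $\lim_{R\to\infty}\int_1^R$ of the integrand exist in $\mathbb{C}$. *)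

(* Defs.v *)
From Stdlib Require Import Reals Lra FunctionalExtensionality ProofIrrelevance.
From Coquelicot Require Import Coquelicot.
Open Scope R_scope.

(* A function on [0,oo) is represented by its unique extension to R that is
   constant on (-oo,0], so that Leibniz equality on Cinf is pointwise equality
   on [0,oo). Only the values on [0,oo) carry information. *)
Definition in_Cinf (f : R -> C) : Prop :=
  continuous_on (fun t => 0 <= t) f /\
  (exists l : C, filterlim f (Rbar_locally p_infty) (locally l)) /\
  (forall t, t < 0 -> f t = f 0).

Record Cinf := mkCinf { cfun :> R -> C; cfun_in : in_Cinf cfun }.

Lemma Cinf_eq (f g : Cinf) : (forall t, 0 <= t -> f t = g t) -> f = g.
Proof.
  destruct f as [f Hf], g as [g Hg]; simpl; intros H.
  assert (E : f = g).
  { apply functional_extensionality; intros t.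
    destruct (Rle_lt_dec 0 t) as [Ht|Ht]; [now apply H|].
    destruct Hf as [_ [_ Hf]], Hg as [_ [_ Hg]].
    rewrite (Hf t Ht), (Hg t Ht); apply H; lra. }
  subst g; f_equal; apply proof_irrelevance.
Qed.

Lemma filterlim_Cmod {X : Type} (F : (X -> Prop) -> Prop) {FF : Filter F}
    (f : X -> C) (l : C) :
  filterlim f F (locally l) <->
  (forall eps, 0 < eps -> F (fun x => Cmod (f x - l) < eps)).
Proof.
  split.
  - intros H eps He.
    exact (proj1 (filterlim_locally_ball_norm (U := C_NormedModule) f l) H
             (mkposreal eps He)).
  - intros H. apply (filterlim_locally_ball_norm (U := C_NormedModule) f l).
    intros eps. exact (H eps (cond_pos eps)).
Qed.

Lemma Cinf_continuous (f : Cinf) (t : R) : continuous f t.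
Proof.
  destruct (cfun_in f) as [Hc [_ Hn]].
  assert (E : forall s, f s = f (Rmax 0 s)).
  { intros s. destruct (Rle_lt_dec 0 s) as [Hs|Hs].
    - now rewrite Rmax_right.
    - rewrite Rmax_left by lra. now apply Hn. }
  apply filterlim_Cmod; [apply locally_filter|]. intros eps He.
  assert (H := Hc (Rmax 0 t) (Rmax_l 0 t)).
  apply filterlim_Cmod with (eps := eps) in H; [|apply within_filter, locally_filter|exact He].
  destruct H as [d Hd]. exists d. intros s Hs.
  rewrite (E s), (E t). apply Hd; [|apply Rmax_l].
  change (Rabs (s - t) < d) in Hs. change (Rabs (Rmax 0 s - Rmax 0 t) < d).
  revert Hs. unfold Rmax.
  destruct (Rle_dec 0 s), (Rle_dec 0 t); intros Hs;
    apply Rabs_def2 in Hs; apply Rabs_def1; lra.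
Qed.

Lemma in_Cinf_intro (f : R -> C) (l : C) :
  (forall t, 0 < t -> continuous f t) ->
  (forall eps, 0 < eps -> exists d, 0 < d /\
     forall t, 0 < t < d -> Cmod (f t - f 0) < eps) ->
  (forall eps, 0 < eps -> exists M, forall t, M < t -> Cmod (f t - l) < eps) ->
  (forall t, t < 0 -> f t = f 0) -> in_Cinf f.
Proof.
  intros Hc H0 Hl Hn. split; [|split; [exists l|exact Hn]].
  - intros t Ht. destruct Ht as [Ht|Ht].
    + eapply filterlim_filter_le_1; [apply filter_le_within|exact (Hc t Ht)].
    + subst t. apply filterlim_Cmod; [apply within_filter, locally_filter|].
      intros eps He. destruct (H0 eps He) as [d [Hd H]].
      exists (mkposreal d Hd). intros s Hs Hs0.
      change (Rabs (s - 0) < d) in Hs. apply Rabs_def2 in Hs.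
      destruct Hs0 as [Hs0|Hs0]; [apply H; lra|].
      subst s. replace (f 0 - f 0)%C with (RtoC 0) by ring.
      now rewrite Cmod_0.
  - apply filterlim_Cmod; [apply Rbar_locally_filter|]. intros eps He.
    exact (Hl eps He).
Qed.

Lemma Cinf_lim (f : Cinf) :
  exists l : C, filterlim f (Rbar_locally p_infty) (locally l).
Proof. exact (proj1 (proj2 (cfun_in f))). Qed.

Lemma Cinf_neg (f : Cinf) (t : R) : t < 0 -> f t = f 0.
Proof. exact (proj2 (proj2 (cfun_in f)) t). Qed.

Lemma Cinf_plus_in (f g : Cinf) : in_Cinf (fun t => f t + g t)%C.
Proof.
  split; [|split].
  - intros t Ht.
    exact (filterlim_comp_2 _ _ _ (proj1 (cfun_in f) t Ht) (proj1 (cfun_in g) t Ht)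
             (filterlim_plus (V := C_NormedModule) (f t) (g t))).
  - destruct (Cinf_lim f) as [l Hl], (Cinf_lim g) as [m Hm].
    exists (l + m)%C.
    exact (filterlim_comp_2 _ _ _ Hl Hm (filterlim_plus (V := C_NormedModule) l m)).
  - intros t Ht. now rewrite (Cinf_neg f t Ht), (Cinf_neg g t Ht).
Qed.

Lemma Cinf_scal_in (k : C) (f : Cinf) : in_Cinf (fun t => k * f t)%C.
Proof.
  split; [|split].
  - intros t Ht.
    exact (filterlim_comp _ _ _ _ _ _ _ _ (proj1 (cfun_in f) t Ht)
             (filterlim_scal_r (V := C_NormedModule) k (f t))).
  - destruct (Cinf_lim f) as [l Hl]. exists (k * l)%C.
    exact (filterlim_comp _ _ _ _ _ _ _ _ Hl
             (filterlim_scal_r (V := C_NormedModule) k l)).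
  - intros t Ht. now rewrite (Cinf_neg f t Ht).
Qed.

Lemma Cinf_const_in (c : C) : in_Cinf (fun _ => c).
Proof.
  split; [|split].
  - intros t _. apply filterlim_const.
  - exists c. apply filterlim_const.
  - reflexivity.
Qed.

Definition Cinf_const (c : C) : Cinf := mkCinf _ (Cinf_const_in c).
Definition Cinf_plus (f g : Cinf) : Cinf := mkCinf _ (Cinf_plus_in f g).
Definition Cinf_scal (k : C) (f : Cinf) : Cinf := mkCinf _ (Cinf_scal_in k f).
Definition Cinf_opp (f : Cinf) : Cinf := Cinf_scal (-(1))%C f.

Definition Cinf_AbelianMonoid_mixin : AbelianMonoid.mixin_of Cinf.
Proof.
  apply (AbelianMonoid.Mixin _ Cinf_plus (Cinf_const 0%C));
    intros; apply Cinf_eq; intros t _; simpl; ring.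
Defined.

Canonical Cinf_AbelianMonoid :=
  AbelianMonoid.Pack Cinf Cinf_AbelianMonoid_mixin Cinf.

Definition Cinf_AbelianGroup_mixin : AbelianGroup.mixin_of Cinf_AbelianMonoid.
Proof.
  apply (AbelianGroup.Mixin _ Cinf_opp).
  intros; apply Cinf_eq; intros t _; simpl; ring.
Defined.

Canonical Cinf_AbelianGroup :=
  AbelianGroup.Pack Cinf
    (AbelianGroup.Class Cinf Cinf_AbelianMonoid_mixin Cinf_AbelianGroup_mixin) Cinf.

Definition Cinf_ModuleSpace_mixin : ModuleSpace.mixin_of C_Ring Cinf_AbelianGroup.
Proof.
  apply (ModuleSpace.Mixin C_Ring Cinf_AbelianGroup Cinf_scal);
    intros; apply Cinf_eq; intros t _; simpl;
    unfold mult, plus, one; simpl; ring.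
Defined.

Canonical Cinf_ModuleSpace :=
  ModuleSpace.Pack C_Ring Cinf
    (ModuleSpace.Class C_Ring Cinf (AbelianGroup.class Cinf_AbelianGroup)
       Cinf_ModuleSpace_mixin) Cinf.

Definition sup_norm (f : Cinf) : R :=
  real (Lub_Rbar (fun r => exists t, 0 <= t /\ r = Cmod (f t))).

Lemma Cinf_bounded (f : Cinf) : exists B, forall t, 0 <= t -> Cmod (f t) <= B.
Proof.
  destruct (Cinf_lim f) as [l Hl].
  apply filterlim_Cmod with (eps := 1) in Hl; [|apply Rbar_locally_filter|lra].
  destruct Hl as [M HM].
  destruct (continuous_ab_maj_consistent (fun t => Cmod (f t)) 0 (Rmax 0 M))
    as [m [Hm _]].
  - apply Rmax_l.
  - intros c _. eapply filterlim_ext;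
      [|exact (filterlim_comp _ _ _ _ _ _ _ _ (Cinf_continuous f c)
             (filterlim_norm (V := C_NormedModule) (f c)))].
    reflexivity.
  - exists (Rmax (Cmod (f m)) (1 + Cmod l)). intros t Ht.
    destruct (Rle_lt_dec t M) as [H|H].
    + eapply Rle_trans; [|apply Rmax_l]. apply Hm. split; [lra|].
      eapply Rle_trans; [exact H|apply Rmax_r].
    + eapply Rle_trans; [|apply Rmax_r]. specialize (HM t H).
      replace (f t) with ((f t - l) + l)%C by ring.
      eapply Rle_trans; [apply Cmod_triangle|lra].
Qed.

Lemma sup_norm_spec (f : Cinf) :
  (forall t, 0 <= t -> Cmod (f t) <= sup_norm f) /\
  (forall B, (forall t, 0 <= t -> Cmod (f t) <= B) -> sup_norm f <= B).
Proof.
  unfold sup_norm.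
  set (E := fun r => exists t, 0 <= t /\ r = Cmod (f t)).
  destruct (Lub_Rbar_correct E) as [Hub Hle].
  destruct (Cinf_bounded f) as [B0 HB0].
  assert (Hb : forall B, (forall t, 0 <= t -> Cmod (f t) <= B) ->
                Rbar_le (Lub_Rbar E) B).
  { intros B HB. apply Hle. intros r [t [Ht ->]]. now apply HB. }
  assert (H0 := Hb B0 HB0).
  assert (H1 : Rbar_le (Cmod (f 0)) (Lub_Rbar E)).
  { apply Hub. exists 0. split; [lra|reflexivity]. }
  destruct (Lub_Rbar E) as [r| |]; simpl in *; try contradiction.
  split; [|exact Hb].
  intros t Ht. apply (Hub (Cmod (f t))). now exists t.
Qed.

Lemma sup_norm_triangle (f g : Cinf) :
  sup_norm (plus f g) <= sup_norm f + sup_norm g.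
Proof.
  apply (proj2 (sup_norm_spec _)). intros t Ht.
  assert (H1 := proj1 (sup_norm_spec f) t Ht).
  assert (H2 := proj1 (sup_norm_spec g) t Ht).
  assert (H3 := Cmod_triangle (f t) (g t)).
  change (Cmod (f t + g t) <= sup_norm f + sup_norm g). lra.
Qed.

Lemma sup_norm_scal (k : C) (f : Cinf) :
  sup_norm (scal k f) <= Cmod k * sup_norm f.
Proof.
  apply (proj2 (sup_norm_spec _)). intros t Ht.
  change (Cmod (k * f t) <= Cmod k * sup_norm f). rewrite Cmod_mult.
  apply Rmult_le_compat_l; [apply Cmod_ge_0|].
  exact (proj1 (sup_norm_spec f) t Ht).
Qed.

Lemma sup_norm_eq_0 (f : Cinf) : sup_norm f = 0 -> f = zero.
Proof.
  intros H. apply Cinf_eq. intros t Ht.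
  assert (H1 := proj1 (sup_norm_spec f) t Ht).
  assert (H2 := Cmod_ge_0 (f t)).
  apply Cmod_eq_0. lra.
Qed.

Definition Cinf_ball (f : Cinf) (eps : R) (g : Cinf) : Prop :=
  sup_norm (minus g f) < eps.

Definition Cinf_UniformSpace_mixin : UniformSpace.mixin_of Cinf.
Proof.
  apply (UniformSpace.Mixin _ zero Cinf_ball).
  - intros f eps. unfold Cinf_ball.
    apply Rle_lt_trans with 0; [|apply cond_pos].
    apply (proj2 (sup_norm_spec _)). intros t Ht. rewrite minus_eq_zero.
    change (Cmod 0 <= 0). rewrite Cmod_0; lra.
  - unfold Cinf_ball. intros f g eps H. eapply Rle_lt_trans; [|exact H].
    replace (minus f g) with (scal (opp one : C) (minus g f)).
    + eapply Rle_trans; [apply sup_norm_scal|].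
      change (Cmod (- (1)) * sup_norm (minus g f) <= sup_norm (minus g f)).
      rewrite Cmod_m1. lra.
    + rewrite scal_opp_one. apply opp_minus.
  - unfold Cinf_ball. intros f g h e1 e2 H1 H2.
    rewrite (minus_trans g).
    eapply Rle_lt_trans; [apply sup_norm_triangle|lra].
Defined.

Canonical Cinf_UniformSpace :=
  UniformSpace.Pack Cinf Cinf_UniformSpace_mixin Cinf.

Canonical Cinf_NormedModuleAux :=
  NormedModuleAux.Pack C_AbsRing Cinf
    (NormedModuleAux.Class C_AbsRing Cinf
       (ModuleSpace.class C_Ring Cinf_ModuleSpace) Cinf_UniformSpace_mixin) Cinf.

Definition Cinf_NormedModule_mixin :
  NormedModule.mixin_of C_AbsRing Cinf_NormedModuleAux.
Proof.
  apply (NormedModule.Mixin C_AbsRing Cinf_NormedModuleAux sup_norm 1).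
  - exact sup_norm_triangle.
  - exact sup_norm_scal.
  - intros f g eps H. exact H.
  - intros f g eps H. rewrite Rmult_1_l. exact H.
  - exact sup_norm_eq_0.
Defined.

Canonical Cinf_NormedModule :=
  NormedModule.Pack C_AbsRing Cinf
    (NormedModule.Class C_AbsRing Cinf
       (NormedModuleAux.class C_AbsRing Cinf_NormedModuleAux)
       Cinf_NormedModule_mixin) Cinf.

Definition cesaro_fun (f : R -> C) (t : R) : C :=
  if Rlt_dec 0 t then (RInt (V := C_R_CompleteNormedModule) f 0 t / RtoC t)%C
  else f 0.

Lemma Cinf_ex_RInt (f : Cinf) (a b : R) : ex_RInt (V := C_R_NormedModule) f a b.
Proof.
  apply (ex_RInt_continuous (V := C_R_CompleteNormedModule)).
  intros z _. apply Cinf_continuous.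
Qed.

(* |(1/t) \int_0^t f - c| is at most (m A + (t - m) B) / t when |f - c| is
   bounded by A on [0,m] and by B on [m,t] *)
Lemma cesaro_dist (f : Cinf) (c : C) (m t A B : R) :
  0 <= m <= t -> 0 < t ->
  (forall s, 0 <= s <= m -> Cmod (f s - c) <= A) ->
  (forall s, m <= s <= t -> Cmod (f s - c) <= B) ->
  Cmod (cesaro_fun f t - c) <= (m * A + (t - m) * B) / t.
Proof.
  intros Hm Ht HA HB. unfold cesaro_fun.
  destruct (Rlt_dec 0 t) as [_|]; [|lra].
  set (g := fun s => minus (f s) c : C_R_CompleteNormedModule).
  assert (Hg : forall a b, ex_RInt (V := C_R_NormedModule) g a b).
  { intros a b. apply (ex_RInt_minus (V := C_R_NormedModule)).
    - apply Cinf_ex_RInt.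
    - apply ex_RInt_const. }
  assert (E : (RInt (V := C_R_CompleteNormedModule) f 0 t / RtoC t - c)%C
            = (RInt (V := C_R_CompleteNormedModule) g 0 t / RtoC t)%C).
  { assert (Eg : RInt (V := C_R_CompleteNormedModule) g 0 t
               = (RInt (V := C_R_CompleteNormedModule) f 0 t - RtoC t * c)%C).
    { etransitivity.
      { apply (RInt_minus (V := C_R_CompleteNormedModule) f (fun _ => c) 0 t);
          [apply Cinf_ex_RInt|apply ex_RInt_const]. }
      rewrite (RInt_const (V := C_R_CompleteNormedModule)), Rminus_0_r.
      rewrite <- scal_R_Cmult. reflexivity. }
    rewrite Eg. field. intros H; apply RtoC_inj in H; lra. }
  rewrite E. rewrite Cmod_div by (intros H; apply RtoC_inj in H; lra).
  rewrite Cmod_R, (Rabs_pos_eq t) by lra.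
  apply Rmult_le_compat_r; [left; now apply Rinv_0_lt_compat|].
  rewrite <- (RInt_Chasles (V := C_R_CompleteNormedModule) g 0 m t) by apply Hg.
  eapply Rle_trans; [apply Cmod_triangle|].
  apply Rplus_le_compat.
  - rewrite <- (Rminus_0_r m) at 2. rewrite Cmod_norm.
    apply (norm_RInt_le_const (V := C_R_NormedModule) g 0 m); [lra| |].
    + intros s Hs. rewrite <- Cmod_norm. apply HA, Hs.
    + apply (RInt_correct (V := C_R_CompleteNormedModule)), Hg.
  - rewrite Cmod_norm.
    apply (norm_RInt_le_const (V := C_R_NormedModule) g m t); [lra| |].
    + intros s Hs. rewrite <- Cmod_norm. apply HB, Hs.
    + apply (RInt_correct (V := C_R_CompleteNormedModule)), Hg.
Qed.

Lemma cesaro_in (f : Cinf) : in_Cinf (cesaro_fun f).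
Proof.
  destruct (Cinf_lim f) as [l Hl].
  assert (E0 : cesaro_fun f 0 = f 0).
  { unfold cesaro_fun. destruct (Rlt_dec 0 0); [lra|reflexivity]. }
  apply in_Cinf_intro with l.
  - intros t Ht.
    eapply (continuous_ext_loc _
      (fun t => scal (/ t) (RInt (V := C_R_CompleteNormedModule) f 0 t)
                : C_R_NormedModule)).
    + exists (mkposreal t Ht). intros s Hs.
      change (Rabs (s - t) < t) in Hs. apply Rabs_def2 in Hs.
      unfold cesaro_fun. destruct (Rlt_dec 0 s); [|lra].
      rewrite scal_R_Cmult, RtoC_inv by lra. apply Cmult_comm.
    + apply (continuous_scal (V := C_R_NormedModule)).
      * apply continuous_Rinv_comp; [apply continuous_id|lra].
      * apply (continuous_RInt_1 (V := C_R_NormedModule) f 0 t).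
        apply filter_forall. intros s.
        apply (RInt_correct (V := C_R_CompleteNormedModule)), Cinf_ex_RInt.
  - intros eps He.
    assert (H := Cinf_continuous f 0).
    apply filterlim_Cmod with (eps := eps / 2) in H;
      [|apply locally_filter|lra].
    destruct H as [d Hd]. exists d. split; [apply cond_pos|].
    intros t Ht. rewrite E0.
    assert (H := cesaro_dist f (f 0) t t (eps / 2) (eps / 2)).
    eapply Rle_lt_trans.
    { apply H; try lra; intros s Hs; left; apply Hd;
        change (Rabs (s - 0) < d); apply Rabs_def1; lra. }
    replace ((t * (eps / 2) + (t - t) * (eps / 2)) / t) with (eps / 2)
      by (field; lra). lra.
  - intros eps He.
    apply filterlim_Cmod with (eps := eps / 2) in Hl;
      [|apply Rbar_locally_filter|lra].
    destruct Hl as [M HM].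
    destruct (Cinf_bounded f) as [B HB].
    set (m := Rmax 0 M + 1). set (A := B + Cmod l).
    assert (Hm : 1 <= m /\ M < m).
    { assert (H1 := Rmax_l 0 M). assert (H2 := Rmax_r 0 M). unfold m. lra. }
    assert (HA : forall s, 0 <= s -> Cmod (f s - l) <= A).
    { intros s Hs. eapply Rle_trans; [apply Cmod_triangle|].
      rewrite Cmod_opp. specialize (HB s Hs). unfold A. lra. }
    assert (HA0 : 0 <= A).
    { eapply Rle_trans; [apply Cmod_ge_0|apply (HA 0); lra]. }
    exists (Rmax m (2 * m * A / eps)). intros t Ht.
    assert (H1 := Rmax_l m (2 * m * A / eps)).
    assert (H2 := Rmax_r m (2 * m * A / eps)).
    eapply Rle_lt_trans.
    { apply (cesaro_dist f l m t A (eps / 2)); try lra.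
      - intros s Hs. apply HA; lra.
      - intros s Hs. left. apply HM. lra. }
    apply Rmult_lt_reg_r with t; [lra|].
    unfold Rdiv at 1. rewrite Rmult_assoc, Rinv_l, Rmult_1_r by lra.
    assert (H3 : 2 * m * A < t * eps).
    { apply Rmult_lt_reg_r with (/ eps); [now apply Rinv_0_lt_compat|].
      rewrite (Rmult_assoc t), Rinv_r, Rmult_1_r by lra.
      unfold Rdiv in H2. lra. }
    assert (0 < m * eps) by (apply Rmult_lt_0_compat; lra).
    lra.
  - intros t Ht. rewrite E0. unfold cesaro_fun.
    destruct (Rlt_dec 0 t); [lra|reflexivity].
Qed.

Definition cesaro (f : Cinf) : Cinf := mkCinf (cesaro_fun f) (cesaro_in f).

Definition Pinit (f : Cinf) : Cinf := Cinf_const (f 0).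

Definition converges_in_norm {V : NormedModule C_AbsRing} (u : nat -> V) : Prop :=
  exists v : V, is_lim_seq (fun n => norm (minus (u n) v)) 0.

Definition converges_weakly {V : NormedModule C_AbsRing} (u : nat -> V) : Prop :=
  exists v : V, forall phi : V -> C,
    is_linear (K := C_AbsRing) (V := C_NormedModule) phi ->
    filterlim (fun n => phi (u n)) eventually (locally (phi v)).

Definition improper_RInt_exists (g : R -> C) : Prop :=
  ex_RInt_gen (V := C_R_NormedModule) g (at_right 0) (at_point 1) /\
  ex_RInt_gen (V := C_R_NormedModule) g (at_point 1) (Rbar_locally p_infty).

(* Main.v *)
(** Both parts rest on the estimate [||T^n g - T^(n+1) g|| <= ||g|| / sqrt n].
    Multiplication by [ln] satisfies [[ln, T] = T^2], so for
    [x0 = ln t - n] the value at [t] of [T^n ((ln - x0) g)] is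
    [n (T^n g - T^(n+1) g)(t)]; it is bounded through
    [|x| <= (x^2 / sqrt n + sqrt n) / 2], because
    [T^n ((ln - x0)^2) = (ln - x0 - n)^2 + n] takes the value [n] at [t].
    For (b), [f - Pf = g - T g] with [g(t) = f(t) - f(0) + \int_0^t (f(s) - f(0)) / s ds].
    For (a), [f - Pf] is uniformly approximated by functions vanishing near 0
    and near infinity, to which (b) applies, and [T] is a contraction. Conversely
    a weak limit [v] is a fixed point of [T], hence constant, and evaluation at 0
    and the limit at infinity are T-invariant continuous functionals. *)

Require Import Defs.
From Stdlib Require Import Reals Lra.
From Coquelicot Require Import Coquelicot.
Open Scope R_scope.

(* [ring] fails when the equality is typed in a Coquelicot structure over C. *)
Ltac ringC := match goal with |- ?a = ?b => change (@eq C a b) end; ring.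

(** * Calculus for complex-valued functions on the open half-line *)

Notation is_deriveC := (is_derive (V := C_R_NormedModule)).

Lemma is_deriveC_scal (k : R -> R) (f : R -> C) (t dk : R) (df : C) :
  is_derive k t dk -> is_deriveC f t df ->
  is_deriveC (fun s => (RtoC (k s) * f s)%C) t
    (RtoC dk * f t + RtoC (k t) * df)%C.
Proof.
  intros Hk Hf.
  assert (H := filterdiff_scal_fct (K := R_AbsRing) (U := R_NormedModule)
                 (V := C_R_NormedModule) t k f _ _ Rmult_comm Hk Hf).
  apply (filterdiff_ext (fun s => scal (k s) (f s : C_R_NormedModule))).
  { intros s. apply scal_R_Cmult. }
  eapply filterdiff_ext_lin; [exact H|].
  intros y. cbv beta. rewrite !scal_R_Cmult.
  change (RtoC (y * dk) * f t + RtoC (k t) * (RtoC y * df)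
    = RtoC y * (RtoC dk * f t + RtoC (k t) * df))%C.
  rewrite RtoC_mult. ring.
Qed.

Lemma is_deriveC_minus (f g : R -> C) (t : R) (df dg : C) :
  is_deriveC f t df -> is_deriveC g t dg ->
  is_deriveC (fun s => (f s - g s)%C) t (df - dg)%C.
Proof. exact (is_derive_minus (V := C_R_NormedModule) f g t df dg). Qed.

Lemma is_deriveC_continuous (f : R -> C) (t : R) (df : C) :
  is_deriveC f t df -> continuous f t.
Proof.
  intros H. apply (ex_derive_continuous (V := C_R_NormedModule)).
  now exists df.
Qed.

Lemma at_right_lt (t : R) : 0 < t -> at_right 0 (fun s => s < t).
Proof.
  intros Ht. exists (mkposreal t Ht). intros s Hs _.
  change (Rabs (s - 0) < t) in Hs. apply Rabs_def2 in Hs. lra.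
Qed.

Lemma at_right_pos : at_right 0 (fun s => 0 < s).
Proof. exists (mkposreal 1 Rlt_0_1). now intros s _. Qed.

(** Substituting y = 1/t turns this into the limit of ln y / y at infinity. *)
Lemma at_right_xlnx (eps : R) :
  0 < eps -> at_right 0 (fun t => t * Rabs (ln t) < eps).
Proof.
  intros He. destruct (proj2 (is_lim_spec _ _ _) is_lim_div_ln_p (mkposreal eps He))
    as [M HM]; simpl in HM.
  assert (HM1 := Rmax_r M 1). assert (HM0 := Rmax_l M 1).
  assert (Hd : 0 < / Rmax M 1) by (apply Rinv_0_lt_compat; lra).
  generalize (filter_and _ _ at_right_pos (at_right_lt _ Hd)).
  apply filter_imp. intros t [Ht0 Ht].
  assert (Hy : Rmax M 1 < / t).
  { rewrite <- (Rinv_inv (Rmax M 1)). apply Rinv_0_lt_contravar; assumption. }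
  specialize (HM (/ t) ltac:(lra)).
  rewrite Rminus_0_r, ln_Rinv in HM by assumption.
  unfold Rdiv in HM. rewrite Rinv_inv, Rabs_mult, Rabs_Ropp, (Rabs_pos_eq t) in HM by lra.
  lra.
Qed.

(** Integrating over [d, t] gives |F t - F d| <= Psi t - Psi d <= Psi t, and F d is arbitrarily
    small for small d. Working on [d, t] avoids any regularity at 0, where logarithms are
    singular. *)
Lemma deriv_bound (F dF : R -> C) (Psi psi : R -> R) :
  (forall t, 0 < t -> is_deriveC F t (dF t)) ->
  (forall t, 0 < t -> continuous dF t) ->
  (forall t, 0 < t -> is_derive Psi t (psi t)) ->
  (forall t, 0 < t -> continuous psi t) ->
  (forall t, 0 < t -> 0 <= Psi t) ->
  (forall t, 0 < t -> Cmod (dF t) <= psi t) ->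
  (forall eps, 0 < eps -> at_right 0 (fun t => Cmod (F t) < eps)) ->
  forall t, 0 < t -> Cmod (F t) <= Psi t.
Proof.
  intros HF HcF HP HcP HP0 Hle H0 t Ht.
  apply Rle_plus_epsilon. intros eps He.
  destruct (filter_ex _ (filter_and _ _ at_right_pos
     (filter_and _ _ (at_right_lt t Ht) (H0 eps He)))) as [d [Hd [Hdt HFd]]].
  assert (I1 : is_RInt (V := C_R_NormedModule) dF d t (F t - F d)%C).
  { apply (is_RInt_derive (V := C_R_CompleteNormedModule) F dF).
    - intros x Hx. apply HF. rewrite Rmin_left in Hx; lra.
    - intros x Hx. apply HcF. rewrite Rmin_left in Hx; lra. }
  assert (I2 : is_RInt psi d t (Psi t - Psi d)).
  { apply (is_RInt_derive Psi psi).
    - intros x Hx. apply HP. rewrite Rmin_left in Hx; lra.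
    - intros x Hx. apply HcP. rewrite Rmin_left in Hx; lra. }
  (* The [eq_ind] term only restates [Hle] with [norm] in place of [Cmod]. *)
  assert (I3 := norm_RInt_le (V := C_R_NormedModule) dF psi d t _ _ (Rlt_le _ _ Hdt)
     (fun x Hx => eq_ind _ (fun r => r <= psi x) (Hle x ltac:(lra)) _ (Cmod_norm _)) I1 I2).
  rewrite <- Cmod_norm in I3.
  replace (F t) with ((F t - F d) + F d)%C by ring.
  eapply Rle_trans; [apply Cmod_triangle|].
  assert (Hp := HP0 d Hd). lra.
Qed.

(** * The Cesàro mean as a primitive, and contractivity *)

Lemma cesaro_pos (f : Cinf) (t : R) :
  0 < t -> cesaro f t = (RInt (V := C_R_CompleteNormedModule) f 0 t / RtoC t)%C.
Proof. intros Ht. simpl. unfold cesaro_fun. now destruct (Rlt_dec 0 t). Qed.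

Lemma cesaro_0 (f : Cinf) : cesaro f 0 = f 0.
Proof. simpl. unfold cesaro_fun. destruct (Rlt_dec 0 0); [lra|reflexivity]. Qed.

Lemma RtoC_neq_0 (t : R) : 0 < t -> RtoC t <> 0%C.
Proof. intros Ht H. apply RtoC_inj in H. lra. Qed.

Lemma mult_cesaro_pos (f : Cinf) (t : R) :
  0 < t -> (RtoC t * cesaro f t)%C = RInt (V := C_R_CompleteNormedModule) f 0 t.
Proof. intros Ht. rewrite cesaro_pos by exact Ht. field. now apply RtoC_neq_0. Qed.

Lemma is_derive_mult_cesaro (f : Cinf) (t : R) :
  0 < t -> is_deriveC (fun s => (RtoC s * cesaro f s)%C) t (f t).
Proof.
  intros Ht.
  apply (is_derive_ext_loc (V := C_R_NormedModule)
     (fun s => RInt (V := C_R_CompleteNormedModule) f 0 s)).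
  - exists (mkposreal t Ht). intros s Hs.
    change (Rabs (s - t) < t) in Hs. apply Rabs_def2 in Hs.
    symmetry. apply mult_cesaro_pos. lra.
  - apply (is_derive_RInt (V := C_R_NormedModule) f _ 0 t).
    + apply filter_forall. intros s.
      apply (RInt_correct (V := C_R_CompleteNormedModule)), Cinf_ex_RInt.
    + apply Cinf_continuous.
Qed.

Lemma cesaro_bound (f : Cinf) (B : R) :
  (forall t, 0 <= t -> Cmod (f t) <= B) ->
  forall t, 0 <= t -> Cmod (cesaro f t) <= B.
Proof.
  intros HB t [Ht|<-]; [|rewrite cesaro_0; apply HB; lra].
  assert (H := cesaro_dist f 0 0 t B B).
  replace (cesaro f t) with (cesaro_fun f t - 0)%C by (simpl; ring).
  eapply Rle_trans.
  - apply H; try lra; intros s Hs;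
      replace (f s - 0)%C with (f s) by ring; apply HB; lra.
  - right. field. lra.
Qed.

Lemma iter_cesaro_bound (f : Cinf) (B : R) (n : nat) :
  (forall t, 0 <= t -> Cmod (f t) <= B) ->
  forall t, 0 <= t -> Cmod (Nat.iter n cesaro f t) <= B.
Proof.
  intros HB. induction n as [|n IH]; [exact HB|]. now apply cesaro_bound.
Qed.

(** * The commutator with the logarithm and the decay of T^n g - T^(n+1) g *)

(* [iter_commutator x0 g m] is the m-th Cesaro iterate of [(ln - x0) g]: since
   [ln, T] = T^2, one has [ln, T^m] = m T^(m+1). *)
Definition iter_commutator (x0 : R) (g : Cinf) (m : nat) (t : R) : C :=
  (RtoC (ln t - x0) * Nat.iter m cesaro g t
   - RtoC (INR m) * Nat.iter (S m) cesaro g t)%C.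

(** The derivative of [ln] contributes one copy of T^(m+1) g, which lowers the coefficient m + 1 to
    m. Together with the vanishing at 0 below, this makes level m + 1 the Cesàro mean of level m,
    although neither need belong to [Cinf]. *)
Lemma is_derive_mult_iter_commutator (x0 : R) (g : Cinf) (m : nat) (t : R) :
  0 < t ->
  is_deriveC (fun s => (RtoC s * iter_commutator x0 g (S m) s)%C) t
    (iter_commutator x0 g m t).
Proof.
  intros Ht.
  apply (is_derive_ext (V := C_R_NormedModule)
    (fun s => (RtoC (ln s - x0) * (RtoC s * cesaro (Nat.iter m cesaro g) s)
       - RtoC (INR (S m)) * (RtoC s * cesaro (Nat.iter (S m) cesaro g) s))%C)).
  { intros s. unfold iter_commutator.
    change (Nat.iter (S m) cesaro g) with (cesaro (Nat.iter m cesaro g)).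
    change (Nat.iter (S (S m)) cesaro g) with (cesaro (cesaro (Nat.iter m cesaro g))).
    ringC. }
  replace (iter_commutator x0 g m t) with
    ((RtoC (/ t) * (RtoC t * cesaro (Nat.iter m cesaro g) t)
       + RtoC (ln t - x0) * Nat.iter m cesaro g t)
     - (RtoC 0 * (RtoC t * cesaro (Nat.iter (S m) cesaro g) t)
        + RtoC (INR (S m)) * Nat.iter (S m) cesaro g t))%C.
  - apply is_deriveC_minus.
    + apply (is_deriveC_scal (fun s => ln s - x0)); [|now apply is_derive_mult_cesaro].
      auto_derive; [exact Ht|field; lra].
    + apply (is_deriveC_scal (fun _ => INR (S m))); [|now apply is_derive_mult_cesaro].
      apply (is_derive_const (INR (S m))).
  - unfold iter_commutator.
    change (Nat.iter (S m) cesaro g) with (cesaro (Nat.iter m cesaro g)).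
    rewrite S_INR, RtoC_plus, RtoC_inv by lra. field. now apply RtoC_neq_0.
Qed.

Lemma iter_commutator_continuous (x0 : R) (g : Cinf) (m : nat) (t : R) :
  0 < t -> continuous (iter_commutator x0 g m) t.
Proof.
  intros Ht. unfold iter_commutator.
  apply (continuous_minus (V := C_R_NormedModule)
    (fun s => (RtoC (ln s - x0) * Nat.iter m cesaro g s)%C)
    (fun s => (RtoC (INR m) * Nat.iter (S m) cesaro g s)%C)).
  - eapply continuous_ext; [intros s; apply scal_R_Cmult|].
    apply (continuous_scal (K := R_AbsRing) (V := C_R_NormedModule)
      (fun s => ln s - x0)); [|apply Cinf_continuous].
    apply (ex_derive_continuous (V := R_NormedModule)). auto_derive. exact Ht.
  - eapply continuous_ext; [intros s; apply scal_R_Cmult|].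
    apply (continuous_scal (K := R_AbsRing) (V := C_R_NormedModule)
      (fun s => INR m)); [apply continuous_const|apply Cinf_continuous].
Qed.

(** The iterates of g are bounded by a common B, so the only singularity is that of ln t, which the
    factor t absorbs. *)
Lemma mult_iter_commutator_at_0 (x0 : R) (g : Cinf) (m : nat) (eps : R) :
  0 < eps -> at_right 0 (fun t => Cmod (RtoC t * iter_commutator x0 g m t) < eps).
Proof.
  intros He. destruct (Cinf_bounded g) as [B HB].
  assert (HB0 : 0 <= B) by (eapply Rle_trans; [apply Cmod_ge_0|apply (HB 0); lra]).
  set (K := (Rabs x0 + INR m) * B).
  assert (HK : 0 <= K).
  { apply Rmult_le_pos; [|exact HB0].
    assert (H1 := Rabs_pos x0). assert (H2 := pos_INR m). lra. }
  assert (E1 : 0 < eps / 2 / (B + 1)) by (apply Rdiv_lt_0_compat; lra).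
  assert (E2 : 0 < eps / 2 / (K + 1)) by (apply Rdiv_lt_0_compat; lra).
  generalize (filter_and _ _ at_right_pos
    (filter_and _ _ (at_right_xlnx _ E1) (at_right_lt _ E2))).
  apply filter_imp. intros t [Ht [H1 H2]].
  apply (Rmult_lt_compat_r (B + 1)) in H1; [|lra].
  apply (Rmult_lt_compat_r (K + 1)) in H2; [|lra].
  unfold Rdiv in H1, H2. rewrite (Rmult_assoc (eps * / 2)), Rinv_l in H1, H2 by lra.
  rewrite Cmod_mult, Cmod_R, Rabs_pos_eq by lra.
  assert (H3 : Cmod (iter_commutator x0 g m t)
    <= (Rabs (ln t) + Rabs x0) * B + INR m * B).
  { unfold iter_commutator. eapply Rle_trans; [apply Cmod_triangle|].
    rewrite Cmod_opp, !Cmod_mult, !Cmod_R, (Rabs_pos_eq (INR m)) by apply pos_INR.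
    apply Rplus_le_compat.
    - apply Rmult_le_compat; [apply Rabs_pos|apply Cmod_ge_0| |].
      + unfold Rminus. eapply Rle_trans; [apply Rabs_triang|]. rewrite Rabs_Ropp. lra.
      + apply iter_cesaro_bound; [exact HB|lra].
    - apply Rmult_le_compat_l; [apply pos_INR|].
      apply iter_cesaro_bound; [exact HB|lra]. }
  apply (Rmult_le_compat_l t) in H3; [|lra].
  assert (H4 : 0 <= t * Rabs (ln t)) by (apply Rmult_le_pos; [lra|apply Rabs_pos]).
  assert (H5 : t * ((Rabs (ln t) + Rabs x0) * B + INR m * B)
     = t * Rabs (ln t) * B + t * K) by (unfold K; ring).
  lra.
Qed.

(* The bounding function [(ln t - x0 - m)^2 + m] is the m-th Cesaro iterate of
   [(ln t - x0)^2], i.e. the second moment of a Gamma(m,1) variable about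
   [ln t - x0]. *)
Lemma iter_commutator_bound (x0 M a b : R) (g : Cinf) (m : nat) :
  0 <= M -> 0 <= a -> 0 <= b ->
  (forall t, 0 <= t -> Cmod (g t) <= M) ->
  (forall x, Rabs x <= a * x ^ 2 + b) ->
  forall t, 0 < t ->
    Cmod (iter_commutator x0 g m t)
    <= M * (a * ((ln t - x0 - INR m) ^ 2 + INR m) + b).
Proof.
  intros HM Ha Hb Hg Hab. induction m as [|m IH]; intros t Ht.
  - unfold iter_commutator. change (Nat.iter 0 cesaro g) with g.
    change (INR 0) with 0.
    replace (RtoC (ln t - x0) * g t - RtoC 0 * Nat.iter 1 cesaro g t)%C
      with (RtoC (ln t - x0) * g t)%C by ring.
    rewrite Cmod_mult, Cmod_R, Rmult_comm.
    apply Rmult_le_compat; [apply Cmod_ge_0|apply Rabs_pos|apply Hg; lra|].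
    eapply Rle_trans; [apply Hab|right; ring].
  - set (Psi := fun s => s * (M * (a * ((ln s - x0 - INR (S m)) ^ 2 + INR (S m)) + b))).
    apply Rmult_le_reg_l with t; [exact Ht|].
    change (t * Cmod (iter_commutator x0 g (S m) t) <= Psi t).
    rewrite <- (Rabs_pos_eq t) at 1 by lra. rewrite <- Cmod_R, <- Cmod_mult.
    apply (deriv_bound (fun s => RtoC s * iter_commutator x0 g (S m) s)%C
      (iter_commutator x0 g m) Psi
      (fun s => M * (a * ((ln s - x0 - INR m) ^ 2 + INR m) + b))); [..|exact Ht].
    + intros s Hs. now apply is_derive_mult_iter_commutator.
    + intros s Hs. now apply iter_commutator_continuous.
    (* With x = ln s - x0 - (m + 1), the derivative of s (x^2 + m + 1) is x^2 + 2 x + m + 1 = (x +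
       1)^2 + m, the second moment at level m. *)
    + intros s Hs. unfold Psi. rewrite S_INR. auto_derive; [exact Hs|field; lra].
    + intros s Hs. apply (ex_derive_continuous (V := R_NormedModule)).
      auto_derive. exact Hs.
    + intros s Hs. unfold Psi.
      apply Rmult_le_pos; [lra|]. apply Rmult_le_pos; [exact HM|].
      apply Rplus_le_le_0_compat; [|exact Hb]. apply Rmult_le_pos; [exact Ha|].
      apply Rplus_le_le_0_compat; [apply pow2_ge_0|apply pos_INR].
    + exact IH.
    + intros eps He. now apply mult_iter_commutator_at_0.
Qed.

Lemma iter_cesaro_0 (f : Cinf) (n : nat) : Nat.iter n cesaro f 0 = f 0.
Proof.
  induction n as [|n IH]; [reflexivity|].
  change (Nat.iter (S n) cesaro f) with (cesaro (Nat.iter n cesaro f)).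
  now rewrite cesaro_0.
Qed.

(* At [ln t - x0 = n] the commutator is [n (T^n - T^(n+1))], while the second
   moment bounding it is just [n]. *)
Lemma iter_cesaro_diff (g : Cinf) (M : R) (n : nat) :
  (0 < n)%nat -> 0 <= M -> (forall t, 0 <= t -> Cmod (g t) <= M) ->
  forall t, 0 <= t ->
    Cmod (Nat.iter n cesaro g t - Nat.iter (S n) cesaro g t) <= M / sqrt (INR n).
Proof.
  intros Hn HM Hg t Ht. apply lt_INR in Hn. change (INR 0) with 0 in Hn.
  set (r := sqrt (INR n)).
  assert (Hr : 0 < r) by now apply sqrt_lt_R0.
  assert (Hrr : r * r = INR n) by (apply sqrt_sqrt; lra).
  destruct Ht as [Ht|<-].
  (* The centre depends on the point t under consideration. With a = 1/(2r) and b = r/2, where r^2 =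
     n, the bound is M (n/(2r) + r/2) = M r, and division by n leaves M / r. *)
  - assert (H := iter_commutator_bound (ln t - INR n) M (/ (2 * r)) (r / 2) g n HM).
    specialize (H ltac:(left; apply Rinv_0_lt_compat; lra) ltac:(lra) Hg).
    assert (Hab : forall x, Rabs x <= / (2 * r) * x ^ 2 + r / 2).
    { intros x. apply Rmult_le_reg_l with (2 * r); [lra|].
      replace (2 * r * (/ (2 * r) * x ^ 2 + r / 2)) with (x ^ 2 + r ^ 2) by (field; lra).
      assert (H1 := pow2_ge_0 (Rabs x - r)). rewrite <- (pow2_abs x). lra. }
    specialize (H Hab t Ht). unfold iter_commutator in H.
    replace (ln t - (ln t - INR n)) with (INR n) in H by ring.
    replace (RtoC (INR n) * Nat.iter n cesaro g t - RtoC (INR n) * Nat.iter (S n) cesaro g t)%C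
      with (RtoC (INR n) * (Nat.iter n cesaro g t - Nat.iter (S n) cesaro g t))%C in H by ring.
    rewrite Cmod_mult, Cmod_R, Rabs_pos_eq in H by lra.
    apply Rmult_le_reg_l with (INR n); [lra|].
    eapply Rle_trans; [exact H|]. right. rewrite <- Hrr. field. lra.
  - rewrite !iter_cesaro_0. replace (g 0 - g 0)%C with (RtoC 0) by ring.
    rewrite Cmod_0. apply Rmult_le_pos; [exact HM|]. left. now apply Rinv_0_lt_compat.
Qed.

(** * Linearity and fixed points of T through uniqueness of primitives *)

Lemma Cinf_minus_val (f g : Cinf) (t : R) : minus f g t = (f t - g t)%C.
Proof.
  change ((f t + - (1) * g t)%C = (f t - g t)%C). ring.
Qed.

Lemma sup_norm_ge_0 (f : Cinf) : 0 <= sup_norm f.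
Proof.
  eapply Rle_trans; [apply Cmod_ge_0|apply (proj1 (sup_norm_spec f) 0); lra].
Qed.

(** [is_deriveC] treats C as a real normed module, so multiplication by a complex k enters as a
    bounded real-linear map composed with f. *)
Lemma is_deriveC_Cmult (k : C) (f : R -> C) (t : R) (df : C) :
  is_deriveC f t df -> is_deriveC (fun s => (k * f s)%C) t (k * df)%C.
Proof.
  intros Hf.
  assert (Hk : is_linear (K := R_AbsRing) (U := C_R_NormedModule)
                 (V := C_R_NormedModule) (fun z : C => (k * z)%C)).
  { apply Build_is_linear.
    - intros x y. apply Cmult_plus_distr_l.
    - intros r x. rewrite !scal_R_Cmult. ringC.
    - exists (Cmod k + 1). assert (H := Cmod_ge_0 k). split; [lra|].
      intros x. rewrite <- !Cmod_norm, Cmod_mult.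
      apply Rmult_le_compat_r; [apply Cmod_ge_0|lra]. }
  eapply filterdiff_ext_lin.
  - exact (filterdiff_comp' (V := C_R_NormedModule) f (fun z : C => (k * z)%C) t _ _ Hf
             (filterdiff_linear _ Hk)).
  - intros y. cbv beta. rewrite !scal_R_Cmult. ringC.
Qed.

Lemma mult_bounded_at_0 (u : R -> C) (B eps : R) :
  0 < eps -> at_right 0 (fun t => Cmod (u t) <= B) ->
  at_right 0 (fun t => Cmod (RtoC t * u t) < eps).
Proof.
  intros He HB.
  assert (HB1 := Rle_abs B).
  assert (E : 0 < eps / (Rabs B + 1))
    by (assert (H := Rabs_pos B); apply Rdiv_lt_0_compat; lra).
  generalize (filter_and _ _ HB (filter_and _ _ at_right_pos (at_right_lt _ E))).
  apply filter_imp. intros t [H [Ht0 Ht]].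
  rewrite Cmod_mult, Cmod_R, Rabs_pos_eq by lra.
  apply (Rmult_lt_compat_r (Rabs B + 1)) in Ht; [|assert (H1 := Rabs_pos B); lra].
  unfold Rdiv in Ht. rewrite Rmult_assoc, Rinv_l, Rmult_1_r in Ht
    by (assert (H1 := Rabs_pos B); lra).
  eapply Rle_lt_trans; [|exact Ht]. apply Rmult_le_compat_l; lra.
Qed.

Lemma mult_Cinf_at_0 (f : Cinf) (eps : R) :
  0 < eps -> at_right 0 (fun t => Cmod (RtoC t * f t) < eps).
Proof.
  intros He. apply (mult_bounded_at_0 f (sup_norm f) eps He).
  generalize at_right_pos. apply filter_imp. intros t Ht.
  apply (proj1 (sup_norm_spec f)). lra.
Qed.

(** This is [deriv_bound] for F - G with the zero function as majorant. *)
Lemma primitive_unique (F G f : R -> C) :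
  (forall t, 0 < t -> is_deriveC F t (f t)) ->
  (forall t, 0 < t -> is_deriveC G t (f t)) ->
  (forall eps, 0 < eps -> at_right 0 (fun t => Cmod (F t) < eps)) ->
  (forall eps, 0 < eps -> at_right 0 (fun t => Cmod (G t) < eps)) ->
  forall t, 0 < t -> F t = G t.
Proof.
  intros HF HG HF0 HG0 t Ht.
  assert (H : Cmod (F t - G t) <= 0).
  { apply (deriv_bound (fun s => F s - G s)%C (fun _ => RtoC 0) (fun _ => 0) (fun _ => 0));
      try (intros; lra).
    - intros s Hs. replace (RtoC 0) with (f s - f s)%C by ring.
      apply is_deriveC_minus; auto.
    - intros s _. apply continuous_const.
    - intros s _. apply (is_derive_const 0).
    - intros s _. apply continuous_const.
    - intros s _. rewrite Cmod_0. lra.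
    - intros eps He.
      generalize (filter_and (F := at_right 0) _ _
        (HF0 (eps / 2) ltac:(lra)) (HG0 (eps / 2) ltac:(lra))).
      apply filter_imp. intros s [H1 H2].
      eapply Rle_lt_trans; [apply Cmod_triangle|]. rewrite Cmod_opp. lra. }
  assert (H1 := Cmod_ge_0 (F t - G t)).
  assert (H2 : (F t - G t)%C = RtoC 0) by (apply Cmod_eq_0; lra).
  replace (F t) with (F t - G t + G t)%C by ring. rewrite H2. ring.
Qed.

(** A Cesàro mean is identified by differentiating a candidate instead of computing an integral;
    linearity, the action on constants and the preimage construction all rest on this. *)
Lemma cesaro_eq (f : Cinf) (G : R -> C) :
  (forall t, 0 < t -> is_deriveC (fun s => (RtoC s * G s)%C) t (f t)) ->
  (forall eps, 0 < eps -> at_right 0 (fun t => Cmod (RtoC t * G t) < eps)) ->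
  forall t, 0 < t -> cesaro f t = G t.
Proof.
  intros HG HG0 t Ht.
  assert (H : (RtoC t * cesaro f t)%C = (RtoC t * G t)%C).
  { apply (primitive_unique (fun s => RtoC s * cesaro f s)%C (fun s => RtoC s * G s)%C f);
      [|exact HG| |exact HG0|exact Ht].
    - intros s Hs. now apply is_derive_mult_cesaro.
    - intros eps He. now apply mult_Cinf_at_0. }
  replace (cesaro f t) with (/ RtoC t * (RtoC t * cesaro f t))%C
    by (field; now apply RtoC_neq_0).
  rewrite H. field. now apply RtoC_neq_0.
Qed.

Lemma cesaro_plus (f g : Cinf) : cesaro (plus f g) = plus (cesaro f) (cesaro g).
Proof.
  apply Cinf_eq. intros t [Ht|<-].
  - apply cesaro_eq; [| |exact Ht].
    + intros s Hs.
      apply (is_derive_ext (V := C_R_NormedModule)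
        (fun s => (RtoC s * cesaro f s + RtoC s * cesaro g s)%C)).
      * intros r. symmetry. exact (Cmult_plus_distr_l _ _ _).
      * apply (is_derive_plus (V := C_R_NormedModule)
          (fun s => RtoC s * cesaro f s)%C (fun s => RtoC s * cesaro g s)%C);
          now apply is_derive_mult_cesaro.
    + intros eps He. now apply mult_Cinf_at_0.
  - rewrite cesaro_0. change (f 0 + g 0 = cesaro f 0 + cesaro g 0)%C.
    now rewrite !cesaro_0.
Qed.

Lemma cesaro_scal (k : C) (f : Cinf) : cesaro (scal k f) = scal k (cesaro f).
Proof.
  apply Cinf_eq. intros t [Ht|<-].
  - apply cesaro_eq; [| |exact Ht].
    + intros s Hs.
      apply (is_derive_ext (V := C_R_NormedModule) (fun s => (k * (RtoC s * cesaro f s))%C)).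
      * intros r.
        change ((k * (RtoC r * cesaro f r))%C = (RtoC r * (k * cesaro f r))%C). ring.
      * apply is_deriveC_Cmult. now apply is_derive_mult_cesaro.
    + intros eps He. now apply mult_Cinf_at_0.
  - rewrite cesaro_0. change (k * f 0 = k * cesaro f 0)%C. now rewrite cesaro_0.
Qed.

Lemma is_linear_iter_cesaro (n : nat) :
  is_linear (K := C_AbsRing) (U := Cinf_NormedModule) (V := Cinf_NormedModule)
    (Nat.iter n cesaro).
Proof.
  induction n as [|n IH]; [apply is_linear_id|].
  apply (is_linear_comp (U := Cinf_NormedModule) (V := Cinf_NormedModule)
    (W := Cinf_NormedModule) _ cesaro IH).
  apply Build_is_linear; [exact cesaro_plus|exact cesaro_scal|].
  exists 1. split; [lra|]. intros f. rewrite Rmult_1_l.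
  change (sup_norm (cesaro f) <= sup_norm f).
  apply (proj2 (sup_norm_spec _)). apply cesaro_bound. apply sup_norm_spec.
Qed.

Lemma iter_cesaro_minus (f g : Cinf) (n : nat) :
  Nat.iter n cesaro (minus f g) = minus (Nat.iter n cesaro f) (Nat.iter n cesaro g).
Proof. exact (linear_minus _ f g (is_linear_iter_cesaro n)). Qed.

Lemma cesaro_const (c : C) : cesaro (Cinf_const c) = Cinf_const c.
Proof.
  apply Cinf_eq. intros t [Ht|<-]; [|now rewrite cesaro_0].
  apply (cesaro_eq (Cinf_const c) (fun _ => c)); [| |exact Ht].
  - intros s _.
    replace (Cinf_const c s) with (RtoC 1 * c + RtoC s * 0)%C by (simpl; ring).
    apply (is_deriveC_scal (fun s => s) (fun _ => c)).
    + apply (is_derive_id s).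
    + apply (is_derive_const (V := C_R_NormedModule) c).
  - intros eps He. exact (mult_Cinf_at_0 (Cinf_const c) eps He).
Qed.

Lemma iter_cesaro_Pinit (f : Cinf) (n : nat) :
  Nat.iter n cesaro (Pinit f) = Pinit f.
Proof.
  induction n as [|n IH]; [reflexivity|].
  change (cesaro (Nat.iter n cesaro (Pinit f)) = Pinit f).
  rewrite IH. apply cesaro_const.
Qed.

Lemma Cinf_at_0 (f : Cinf) (eps : R) :
  0 < eps -> at_right 0 (fun t => Cmod (f t - f 0) < eps).
Proof.
  intros He. apply filter_le_within.
  exact (proj1 (filterlim_Cmod (locally 0) f (f 0)) (Cinf_continuous f 0) eps He).
Qed.

(** If v = Tv, then v is (1/t) times the primitive t Tv of v, hence differentiable on (0, oo), and
    the product rule gives v' = -Tv/t + v/t = 0. Continuity at 0 fixes the constant. *)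
Lemma cesaro_fixed_const (v : Cinf) : cesaro v = v -> forall t, 0 <= t -> v t = v 0.
Proof.
  intros Hv t [Ht|<-]; [|reflexivity].
  assert (Hd : forall s, 0 < s -> is_deriveC (fun r => v r - v 0)%C s (RtoC 0)).
  { intros s Hs. replace (RtoC 0) with
      ((RtoC (- / s ^ 2) * (RtoC s * cesaro v s) + RtoC (/ s) * v s) - 0)%C.
    - apply is_deriveC_minus;
        [|apply (is_derive_const (V := C_R_NormedModule) (v 0))].
      apply (is_derive_ext_loc (V := C_R_NormedModule)
        (fun r => RtoC (/ r) * (RtoC r * cesaro v r))%C).
      + exists (mkposreal s Hs). intros r Hr.
        change (Rabs (r - s) < s) in Hr. apply Rabs_def2 in Hr.
        change ((RtoC (/ r) * (RtoC r * cesaro v r))%C = v r).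
        rewrite Hv, RtoC_inv by lra. field. apply RtoC_neq_0. lra.
      + apply (is_deriveC_scal (fun r => / r)); [|now apply is_derive_mult_cesaro].
        auto_derive; [lra|field; lra].
    - rewrite Hv, RtoC_opp, !RtoC_inv, RtoC_pow by (try apply pow_nonzero; lra).
      field. now apply RtoC_neq_0. }
  replace (v t) with (v t - v 0 + v 0)%C by ring.
  rewrite (primitive_unique (fun r => v r - v 0)%C (fun _ => RtoC 0) (fun _ => RtoC 0)
    Hd); [ring|..|exact Ht].
  - intros s _. apply (is_derive_const (V := C_R_NormedModule) (RtoC 0)).
  - intros eps He. now apply Cinf_at_0.
  - intros eps He. apply filter_forall. intros s. now rewrite Cmod_0.
Qed.

(** * Preimages under I - T and improper integrals *)

(* With [H] a primitive of [h t / t] vanishing at 0, [g = H + h] satisfies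
   [T g = H], because [(t H)' = H + h]. *)
Lemma cesaro_preimage (h : Cinf) (H : R -> C) (A : C) :
  h 0 = 0%C ->
  (forall t, 0 < t -> is_deriveC H t (h t / RtoC t)%C) ->
  (forall eps, 0 < eps -> at_right 0 (fun t => Cmod (H t) < eps)) ->
  filterlim H (Rbar_locally p_infty) (locally A) ->
  exists g : Cinf, minus g (cesaro g) = h.
Proof.
  intros Hh0 HH H0 HA. destruct (Cinf_lim h) as [l Hl].
  set (G := fun t => if Rlt_dec 0 t then (H t + h t)%C else RtoC 0).
  assert (Gpos : forall t, 0 < t -> G t = (H t + h t)%C).
  { intros t Ht. unfold G. now destruct (Rlt_dec 0 t). }
  assert (Gneg : forall t, t <= 0 -> G t = RtoC 0).
  { intros t Ht. unfold G. destruct (Rlt_dec 0 t); [lra|reflexivity]. }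
  assert (HG : in_Cinf G).
  { apply in_Cinf_intro with (A + l)%C.
    - intros t Ht.
      apply (continuous_ext_loc _ (fun s => H s + h s)%C).
      + exists (mkposreal t Ht). intros s Hs.
        change (Rabs (s - t) < t) in Hs. apply Rabs_def2 in Hs.
        symmetry. apply Gpos. lra.
      + apply (continuous_plus (V := C_R_NormedModule) H h).
        * apply (is_deriveC_continuous H t _ (HH t Ht)).
        * apply Cinf_continuous.
    - intros eps He.
      destruct (filter_and (F := at_right 0) _ _
        (H0 (eps / 2) ltac:(lra)) (Cinf_at_0 h (eps / 2) ltac:(lra)))
        as [d Hd].
      exists d. split; [apply cond_pos|]. intros t Ht.
      destruct (Hd t) as [H1 H2].
      { change (Rabs (t - 0) < d). apply Rabs_def1; lra. }
      { lra. }
      rewrite Gpos, (Gneg 0) by lra. rewrite Hh0 in H2.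
      replace (H t + h t - 0)%C with (H t + (h t - 0))%C by ring.
      eapply Rle_lt_trans; [apply Cmod_triangle|lra].
    - intros eps He.
      assert (HS := filterlim_comp_2 _ _ _ HA Hl (filterlim_plus (V := C_NormedModule) A l)).
      apply filterlim_Cmod with (eps := eps) in HS; [|apply Rbar_locally_filter|exact He].
      destruct HS as [M HM]. exists (Rmax 0 M). intros t Ht.
      assert (H1 := Rmax_l 0 M). assert (H2 := Rmax_r 0 M).
      rewrite Gpos by lra. apply HM. lra.
    - intros t Ht. rewrite !Gneg by lra. reflexivity. }
  set (g := mkCinf G HG).
  exists g. apply Cinf_eq. intros t Ht. rewrite Cinf_minus_val.
  change (g t) with (G t). destruct Ht as [Ht|<-].
  - rewrite (cesaro_eq g H); [rewrite Gpos by exact Ht; ring|..|exact Ht].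
    + intros s Hs. change (g s) with (G s). rewrite Gpos by exact Hs.
      replace (H s + h s)%C with (RtoC 1 * H s + RtoC s * (h s / RtoC s))%C
        by (field; now apply RtoC_neq_0).
      apply (is_deriveC_scal (fun r => r)); [apply (is_derive_id s)|now apply HH].
    + intros eps He. apply (mult_bounded_at_0 H 1 eps He).
      generalize (H0 1 Rlt_0_1). apply filter_imp. intros s Hs. lra.
  - rewrite cesaro_0. change (g 0) with (G 0). rewrite Hh0. ring.
Qed.

(** Here T^n h = T^n g - T^(n+1) g, so the decay of consecutive differences becomes a rate for every
    h in the range of I - T. *)
Lemma iter_cesaro_rate (g h : Cinf) (n : nat) :
  minus g (cesaro g) = h -> (0 < n)%nat -> forall t, 0 <= t ->
  Cmod (Nat.iter n cesaro h t) <= sup_norm g / sqrt (INR n).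
Proof.
  intros <- Hn t Ht. rewrite iter_cesaro_minus, Cinf_minus_val.
  rewrite <- Nat.iter_succ_r.
  apply iter_cesaro_diff; [exact Hn|apply sup_norm_ge_0|apply sup_norm_spec|exact Ht].
Qed.

(** The generalized integral is relational: it supplies some integral value close to A. Uniqueness
    of the integral replaces that value by [RInt]. *)
Lemma is_RInt_gen_Cmod (phi : R -> C) (Fa Fb : (R -> Prop) -> Prop)
    {FFa : Filter Fa} {FFb : Filter Fb} (A : C) (eps : R) :
  is_RInt_gen (V := C_R_NormedModule) phi Fa Fb A -> 0 < eps ->
  filter_prod Fa Fb
    (fun ab => Cmod (RInt (V := C_R_CompleteNormedModule) phi (fst ab) (snd ab) - A) < eps).
Proof.
  intros HI He.
  assert (HP : filter_prod Fa Fb (fun ab => exists y,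
      is_RInt (V := C_R_NormedModule) phi (fst ab) (snd ab) y /\ Cmod (y - A) < eps)).
  { apply (HI (fun y => Cmod (y - A) < eps)).
    exact (proj1 (filterlim_Cmod (locally A) (fun z => z) A) (filterlim_id _ _) eps He). }
  revert HP. apply filter_imp. intros ab [y [Hy H]].
  now rewrite (is_RInt_unique (V := C_R_CompleteNormedModule) phi _ _ y Hy).
Qed.

Lemma filter_prod_at_point_r (Fa : (R -> Prop) -> Prop) {FFa : Filter Fa} (b : R)
    (P : R * R -> Prop) :
  filter_prod Fa (at_point b) P -> Fa (fun a => P (a, b)).
Proof.
  intros [Q R HQ HR H]. revert HQ. apply filter_imp. intros a Ha. now apply H.
Qed.

Lemma filter_prod_at_point_l (Fb : (R -> Prop) -> Prop) {FFb : Filter Fb} (a : R)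
    (P : R * R -> Prop) :
  filter_prod (at_point a) Fb P -> Fb (fun b => P (a, b)).
Proof.
  intros [Q R HQ HR H]. revert HR. apply filter_imp. intros b Hb. now apply H.
Qed.

Lemma Cinf_div_continuous (h : Cinf) (t : R) :
  0 < t -> continuous (fun s => (h s / RtoC s)%C) t.
Proof.
  intros Ht.
  apply (continuous_ext_loc _ (fun s => scal (/ s) (h s : C_R_NormedModule))).
  - exists (mkposreal t Ht). intros s Hs.
    change (Rabs (s - t) < t) in Hs. apply Rabs_def2 in Hs.
    rewrite scal_R_Cmult, RtoC_inv by lra. apply Cmult_comm.
  - apply (continuous_scal (V := C_R_NormedModule)).
    + apply continuous_Rinv; lra.
    + apply Cinf_continuous.
Qed.

Lemma improper_cesaro_preimage (h : Cinf) :
  h 0 = 0%C -> improper_RInt_exists (fun t => h t / RtoC t)%C ->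
  exists g : Cinf, minus g (cesaro g) = h.
Proof.
  set (phi := fun t => (h t / RtoC t)%C). intros Hh0 [[A HA] [B HB]].
  assert (Hex : forall a b, 0 < a -> 0 < b -> ex_RInt (V := C_R_NormedModule) phi a b).
  { intros a b Ha Hb. apply (ex_RInt_continuous (V := C_R_CompleteNormedModule)).
    intros z Hz. apply Cinf_div_continuous.
    eapply Rlt_le_trans; [|apply Hz]. now apply Rmin_glb_lt. }
  (* A is the integral over (0, 1) and B the one over (1, oo), so this primitive of [phi] tends to 0
     at 0 and to A + B at infinity. *)
  apply (cesaro_preimage h
    (fun t => A + RInt (V := C_R_CompleteNormedModule) phi 1 t)%C (A + B)%C Hh0).
  - intros t Ht. replace (h t / RtoC t)%C with (0 + phi t)%C by (unfold phi; ring).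
    apply (is_derive_plus (V := C_R_NormedModule) (fun _ => A)
      (fun t => RInt (V := C_R_CompleteNormedModule) phi 1 t)).
    + apply (is_derive_const (V := C_R_NormedModule) A).
    + apply (is_derive_RInt (V := C_R_NormedModule) phi _ 1 t);
        [|now apply Cinf_div_continuous].
      exists (mkposreal t Ht). intros s Hs.
      change (Rabs (s - t) < t) in Hs. apply Rabs_def2 in Hs.
      apply (RInt_correct (V := C_R_CompleteNormedModule)), Hex; lra.
  - intros eps He.
    generalize (filter_and _ _ at_right_pos
      (filter_prod_at_point_r _ _ _ (is_RInt_gen_Cmod phi _ _ A eps HA He))).
    apply filter_imp. intros t [Ht H]. simpl in H.
    (* Reversing the limits shows that the primitive at t is minus the error of the integral over
       [t, 1] as an approximation of A. *)
    rewrite <- (opp_RInt_swap (V := C_R_CompleteNormedModule)) by (apply Hex; lra).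
    rewrite <- Cmod_opp. eapply Rle_lt_trans; [right|exact H]. f_equal.
    change (- (A + - RInt (V := C_R_CompleteNormedModule) phi t 1)
      = RInt (V := C_R_CompleteNormedModule) phi t 1 - A)%C. ring.
  - apply filterlim_Cmod; [apply Rbar_locally_filter|]. intros eps He.
    generalize (filter_prod_at_point_l _ _ _ (is_RInt_gen_Cmod phi _ _ B eps HB He)).
    apply filter_imp. intros t H. simpl in H.
    eapply Rle_lt_trans; [right|exact H]. f_equal. ring.
Qed.

(** * Approximation by functions vanishing near 0 and near infinity *)

(** Reduces the continuity of the maximum in [shrink_fun] to that of the absolute value. *)
Lemma Rmax_Rabs (x y : R) : Rmax x y = (x + y + Rabs (x - y)) / 2.
Proof.
  unfold Rmax. destruct (Rle_dec x y).
  - rewrite Rabs_left1 by lra. lra.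
  - rewrite Rabs_pos_eq by lra. lra.
Qed.

(** Radial soft thresholding: values of modulus at most eps go to 0, and the others move towards 0
    by exactly eps. A cutoff in t is thus avoided: continuity is inherited from f, and a zero limit
    of f at an endpoint becomes vanishing near it. The maximum also keeps the denominator positive
    when eps is. *)
Definition shrink_fun (eps : R) (f : R -> C) (t : R) : C :=
  (RtoC (1 - eps / Rmax (Cmod (f t)) eps) * f t)%C.

Lemma shrink_factor (eps x : R) : 0 < eps -> 0 <= 1 - eps / Rmax x eps <= 1.
Proof.
  intros He. assert (H := Rmax_r x eps).
  assert (H1 : 0 <= eps / Rmax x eps) by (apply Rlt_le, Rdiv_lt_0_compat; lra).
  assert (H2 : eps / Rmax x eps <= 1).
  { apply Rmult_le_reg_r with (Rmax x eps); [lra|].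
    unfold Rdiv. rewrite Rmult_assoc, Rinv_l by lra. lra. }
  lra.
Qed.

Lemma shrink_le (eps : R) (f : R -> C) (t : R) :
  0 < eps -> Cmod (shrink_fun eps f t) <= Cmod (f t).
Proof.
  intros He. unfold shrink_fun. rewrite Cmod_mult, Cmod_R.
  assert (H := shrink_factor eps (Cmod (f t)) He).
  rewrite Rabs_pos_eq by lra.
  assert (H1 := Rmult_le_compat_r _ _ _ (Cmod_ge_0 (f t)) (proj2 H)). lra.
Qed.

Lemma shrink_small (eps : R) (f : R -> C) (t : R) :
  0 < eps -> Cmod (f t) <= eps -> shrink_fun eps f t = RtoC 0.
Proof.
  intros He H. unfold shrink_fun. rewrite Rmax_right by exact H.
  replace (1 - eps / eps) with 0 by (field; lra). ring.
Qed.

Lemma shrink_dist (eps : R) (f : R -> C) (t : R) :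
  0 < eps -> Cmod (f t - shrink_fun eps f t) <= eps.
Proof.
  intros He. unfold shrink_fun.
  assert (H := Rmax_r (Cmod (f t)) eps). assert (H1 := Rmax_l (Cmod (f t)) eps).
  replace (f t - RtoC (1 - eps / Rmax (Cmod (f t)) eps) * f t)%C
    with (RtoC (eps / Rmax (Cmod (f t)) eps) * f t)%C
    by (rewrite RtoC_minus; ring).
  rewrite Cmod_mult, Cmod_R, Rabs_pos_eq by (apply Rlt_le, Rdiv_lt_0_compat; lra).
  apply Rmult_le_reg_r with (Rmax (Cmod (f t)) eps); [lra|].
  replace (eps / Rmax (Cmod (f t)) eps * Cmod (f t) * Rmax (Cmod (f t)) eps)
    with (eps * Cmod (f t)) by (field; lra).
  apply Rmult_le_compat_l; lra.
Qed.

Lemma shrink_in (eps : R) (f : Cinf) :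
  0 < eps -> f 0 = RtoC 0 ->
  filterlim f (Rbar_locally p_infty) (locally (RtoC 0)) ->
  in_Cinf (shrink_fun eps f).
Proof.
  intros He Hf0 Hlim.
  assert (E0 : shrink_fun eps f 0 = RtoC 0).
  { apply shrink_small; [exact He|]. rewrite Hf0, Cmod_0. lra. }
  apply in_Cinf_intro with (RtoC 0).
  - intros t Ht.
    assert (Hc : continuous (fun s => Cmod (f s)) t).
    { eapply continuous_ext; [intros s; symmetry; apply Cmod_norm|].
      exact (filterlim_comp _ _ _ _ _ _ _ _ (Cinf_continuous f t)
               (filterlim_norm (V := C_R_NormedModule) (f t))). }
    apply (continuous_ext (fun s =>
      scal (1 - eps * / ((Cmod (f s) + eps + Rabs (Cmod (f s) - eps)) * / 2))
        (f s : C_R_NormedModule))).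
    { intros s. rewrite scal_R_Cmult. unfold shrink_fun. now rewrite Rmax_Rabs. }
    apply (continuous_scal (K := R_AbsRing) (V := C_R_NormedModule)
      (fun s => 1 - eps * / ((Cmod (f s) + eps + Rabs (Cmod (f s) - eps)) * / 2)));
      [|apply Cinf_continuous].
    apply (continuous_minus (V := R_NormedModule) (fun _ => 1));
      [apply continuous_const|].
    apply (continuous_mult (K := R_AbsRing) (fun _ => eps)); [apply continuous_const|].
    apply continuous_Rinv_comp.
    + apply (continuous_mult (K := R_AbsRing) _ (fun _ => / 2)); [|apply continuous_const].
      apply (continuous_plus (V := R_NormedModule) (fun s => Cmod (f s) + eps)).
      * apply (continuous_plus (V := R_NormedModule) (fun s => Cmod (f s)));
          [exact Hc|apply continuous_const].
      * apply continuous_Rabs_comp.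
        apply (continuous_minus (V := R_NormedModule) (fun s => Cmod (f s)));
          [exact Hc|apply continuous_const].
    + assert (H1 := Cmod_ge_0 (f t)). assert (H2 := Rabs_pos (Cmod (f t) - eps)). lra.
  - intros e He0. destruct (Cinf_at_0 f e He0) as [d Hd].
    exists d. split; [apply cond_pos|]. intros t Ht. rewrite E0.
    replace (shrink_fun eps f t - 0)%C with (shrink_fun eps f t) by ring.
    eapply Rle_lt_trans; [now apply shrink_le|].
    replace (f t) with (f t - f 0)%C by (rewrite Hf0; ring). apply Hd; [|lra].
    change (Rabs (t - 0) < d). apply Rabs_def1; lra.
  - intros e He0. apply filterlim_Cmod with (eps := e) in Hlim;
      [|apply Rbar_locally_filter|exact He0].
    destruct Hlim as [M HM]. exists M. intros t Ht.
    replace (shrink_fun eps f t - 0)%C with (shrink_fun eps f t) by ring.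
    eapply Rle_lt_trans; [now apply shrink_le|].
    replace (f t) with (f t - 0)%C by ring. now apply HM.
  - intros t Ht. unfold shrink_fun. now rewrite (Cinf_neg f t Ht).
Qed.

Lemma is_RInt_eq_0 (phi : R -> C) (a b : R) :
  a <= b -> (forall t, a < t < b -> phi t = RtoC 0) ->
  is_RInt (V := C_R_NormedModule) phi a b (RtoC 0).
Proof.
  intros Hab H.
  apply (is_RInt_ext (V := C_R_NormedModule) (fun _ => RtoC 0)).
  - intros t Ht. rewrite Rmin_left, Rmax_right in Ht by exact Hab. now rewrite H.
  - assert (E : scal (b - a) (RtoC 0 : C_R_NormedModule) = RtoC 0)
      by (rewrite scal_R_Cmult; ringC).
    exact (eq_ind _ (is_RInt (V := C_R_NormedModule) (fun _ => RtoC 0) a b)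
      (is_RInt_const (V := C_R_NormedModule) a b (RtoC 0)) _ E).
Qed.

(** Both one-sided integrals are eventually constant: moving the outer limit within the region where
    h vanishes adds an integral of 0. *)
Lemma improper_RInt_exists_compact_support (h : Cinf) :
  at_right 0 (fun t => h t = RtoC 0) ->
  Rbar_locally p_infty (fun t => h t = RtoC 0) ->
  improper_RInt_exists (fun t => h t / RtoC t)%C.
Proof.
  set (phi := fun t => (h t / RtoC t)%C). intros [d Hd] [M HM].
  assert (Hphi : forall t, h t = RtoC 0 -> phi t = RtoC 0).
  { intros t Ht. unfold phi. rewrite Ht. apply Cmult_0_l. }
  assert (Hex : forall a b, 0 < a -> 0 < b -> is_RInt (V := C_R_NormedModule) phi a b
                  (RInt (V := C_R_CompleteNormedModule) phi a b)).
  { intros a b Ha Hb. apply (RInt_correct (V := C_R_CompleteNormedModule)).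
    apply (ex_RInt_continuous (V := C_R_CompleteNormedModule)).
    intros z Hz. apply Cinf_div_continuous.
    eapply Rlt_le_trans; [|apply Hz]. now apply Rmin_glb_lt. }
  assert (Hd0 := cond_pos d).
  split.
  (* The point d / 2 may lie beyond 1; the integrals are oriented and [Hex] covers both orders. *)
  - exists (RInt (V := C_R_CompleteNormedModule) phi (d / 2) 1). intros P HP.
    exists (fun t => 0 < t /\ t < d / 2) (fun t => t = 1); [|reflexivity|].
    + apply (filter_and (F := at_right 0)); [apply at_right_pos|apply at_right_lt; lra].
    + intros x y [Hx0 Hx] ->. exists (RInt (V := C_R_CompleteNormedModule) phi (d / 2) 1).
      split; [|now apply locally_singleton]. simpl.
      replace (RInt (V := C_R_CompleteNormedModule) phi (d / 2) 1)
        with (0 + RInt (V := C_R_CompleteNormedModule) phi (d / 2) 1)%C by ringC.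
      apply (is_RInt_Chasles (V := C_R_NormedModule) phi x (d / 2) 1);
        [|apply Hex; lra].
      apply is_RInt_eq_0; [lra|]. intros t Ht. apply Hphi, Hd; [|lra].
      change (Rabs (t - 0) < d). apply Rabs_def1; lra.
  - set (N := Rmax 1 M).
    assert (H1 := Rmax_l 1 M : 1 <= N). assert (H2 := Rmax_r 1 M : M <= N).
    exists (RInt (V := C_R_CompleteNormedModule) phi 1 N). intros P HP.
    exists (fun t => t = 1) (fun t => N < t); [reflexivity|now exists N|].
    intros x y -> Hy. exists (RInt (V := C_R_CompleteNormedModule) phi 1 N).
    split; [|now apply locally_singleton]. simpl.
    replace (RInt (V := C_R_CompleteNormedModule) phi 1 N)
      with (RInt (V := C_R_CompleteNormedModule) phi 1 N + 0)%C by ringC.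
    apply (is_RInt_Chasles (V := C_R_NormedModule) phi 1 N y); [apply Hex; lra|].
    apply is_RInt_eq_0; [lra|]. intros t Ht. apply Hphi, HM. lra.
Qed.

(** The thresholded function u lies in the range of I - T, so its iterates decay; the remainder h -
    u has norm at most eps / 2, and contractivity preserves this bound for every n. *)
Lemma iter_cesaro_small (h : Cinf) (eps : R) :
  0 < eps -> h 0 = RtoC 0 ->
  filterlim h (Rbar_locally p_infty) (locally (RtoC 0)) ->
  eventually (fun n => sup_norm (Nat.iter n cesaro h) <= eps).
Proof.
  intros He Hh0 Hlim. assert (He2 : 0 < eps / 2) by lra.
  set (u := mkCinf _ (shrink_in _ h He2 Hh0 Hlim)).
  assert (Hsmall : forall t, Cmod (h t) < eps / 2 -> u t = RtoC 0).
  { intros t Ht. apply shrink_small; lra. }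
  destruct (improper_cesaro_preimage u) as [g Hg].
  - apply Hsmall. rewrite Hh0, Cmod_0. exact He2.
  - apply improper_RInt_exists_compact_support.
    + generalize (Cinf_at_0 h _ He2). apply filter_imp. intros t Ht.
      apply Hsmall. now replace (h t) with (h t - h 0)%C by (rewrite Hh0; ring).
    + generalize (proj1 (filterlim_Cmod _ h _) Hlim _ He2). apply filter_imp. intros t Ht.
      apply Hsmall. now replace (h t) with (h t - 0)%C by ring.
  - set (K := sup_norm g).
    assert (HK : 0 <= K) by apply sup_norm_ge_0.
    (* Beyond this N, K / sqrt n <= eps / 2; starting at [S N] also makes n positive. *)
    destruct (INR_unbounded ((K / (eps / 2)) ^ 2)) as [N HN].
    exists (S N). intros n Hn. apply le_INR in Hn. rewrite S_INR in Hn.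
    assert (Hn0 : 0 < INR n) by (assert (H := pos_INR N); lra).
    assert (Hr : K / (eps / 2) <= sqrt (INR n)).
    { rewrite <- (sqrt_pow2 (K / (eps / 2))) by (apply Rdiv_le_0_compat; lra).
      apply sqrt_le_1_alt. lra. }
    assert (Hs : 0 < sqrt (INR n)) by now apply sqrt_lt_R0.
    assert (HKn : K / sqrt (INR n) <= eps / 2).
    { apply Rmult_le_reg_r with (sqrt (INR n)); [exact Hs|].
      apply Rmult_le_compat_r with (r := eps / 2) in Hr; [|lra].
      unfold Rdiv in *. rewrite Rmult_assoc, Rinv_l in * by lra. lra. }
    apply (proj2 (sup_norm_spec _)). intros t Ht.
    replace (Nat.iter n cesaro h t) with
      (Nat.iter n cesaro u t + Nat.iter n cesaro (minus h u) t)%C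
      by (rewrite iter_cesaro_minus, Cinf_minus_val; ring).
    eapply Rle_trans; [apply Cmod_triangle|].
    replace eps with (eps / 2 + eps / 2) by field. apply Rplus_le_compat.
    + eapply Rle_trans; [|exact HKn]. apply iter_cesaro_rate; [exact Hg| |exact Ht].
      apply INR_lt. exact Hn0.
    + apply iter_cesaro_bound; [|exact Ht]. intros s _.
      rewrite Cinf_minus_val. now apply shrink_dist.
Qed.

(** * Norm convergence to Pf *)

Lemma minus_Pinit_at_0 (f : Cinf) : minus f (Pinit f) 0 = RtoC 0.
Proof. rewrite Cinf_minus_val. simpl. ring. Qed.

Lemma iter_cesaro_minus_Pinit (f : Cinf) (n : nat) :
  minus (Nat.iter n cesaro f) (Pinit f) = Nat.iter n cesaro (minus f (Pinit f)).
Proof. now rewrite iter_cesaro_minus, iter_cesaro_Pinit. Qed.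

Lemma iter_cesaro_cv (f : Cinf) :
  filterlim f (Rbar_locally p_infty) (locally (f 0)) ->
  is_lim_seq (fun n => sup_norm (minus (Nat.iter n cesaro f) (Pinit f))) 0.
Proof.
  intros Hf. apply is_lim_seq_spec. intros eps.
  assert (He : 0 < eps / 2) by (assert (H := cond_pos eps); lra).
  assert (Hlim : filterlim (minus f (Pinit f)) (Rbar_locally p_infty) (locally (RtoC 0))).
  { apply filterlim_Cmod; [apply Rbar_locally_filter|]. intros e He0.
    apply filterlim_Cmod with (eps := e) in Hf; [|apply Rbar_locally_filter|exact He0].
    revert Hf. apply filter_imp. intros t Ht. rewrite Cinf_minus_val. simpl.
    now replace (f t - f 0 - 0)%C with (f t - f 0)%C by ring. }
  generalize (iter_cesaro_small _ _ He (minus_Pinit_at_0 f) Hlim).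
  apply filter_imp. intros n Hn.
  rewrite iter_cesaro_minus_Pinit, Rminus_0_r, Rabs_pos_eq by apply sup_norm_ge_0.
  assert (H := cond_pos eps). lra.
Qed.

(** * Invariant functionals and weak limits *)

Lemma is_linear_eval (t : R) :
  0 <= t ->
  is_linear (K := C_AbsRing) (U := Cinf_NormedModule) (V := C_NormedModule)
    (fun f : Cinf => f t).
Proof.
  intros Ht. apply Build_is_linear; [reflexivity|reflexivity|].
  exists 1. split; [lra|]. intros f. rewrite Rmult_1_l.
  exact (proj1 (sup_norm_spec f) t Ht).
Qed.

(** [iota] selects the unique limit, so the limit at infinity becomes a total function on [Cinf]
    that can be tested against weak convergence. *)
Definition lim_infty (f : Cinf) : C :=
  iota (T := C_R_CompleteNormedModule)
    (fun l => filterlim f (Rbar_locally p_infty) (locally l)).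

Lemma lim_infty_unique (f : Cinf) (l : C) :
  filterlim f (Rbar_locally p_infty) (locally l) -> lim_infty f = l.
Proof.
  exact (iota_filterlim_locally (V := C_R_CompleteNormedModule) f l).
Qed.

Lemma lim_infty_spec (f : Cinf) :
  filterlim f (Rbar_locally p_infty) (locally (lim_infty f)).
Proof.
  destruct (Cinf_lim f) as [l Hl]. now rewrite (lim_infty_unique f l Hl).
Qed.

Lemma is_linear_lim_infty :
  is_linear (K := C_AbsRing) (U := Cinf_NormedModule) (V := C_NormedModule) lim_infty.
Proof.
  apply Build_is_linear.
  - intros f g. apply lim_infty_unique.
    exact (filterlim_comp_2 _ _ _ (lim_infty_spec f) (lim_infty_spec g)
             (filterlim_plus (V := C_NormedModule) _ _)).
  - intros k f. apply lim_infty_unique.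
    exact (filterlim_comp _ _ _ _ _ _ _ _ (lim_infty_spec f)
             (filterlim_scal_r (V := C_NormedModule) k _)).
  - exists 1. split; [lra|]. intros f. rewrite Rmult_1_l.
    assert (H := filterlim_comp _ _ _ _ _ _ _ _ (lim_infty_spec f)
      (filterlim_norm (V := C_NormedModule) (lim_infty f))).
    apply (filterlim_le (F := Rbar_locally p_infty) (fun t => norm (f t : C_NormedModule))
      (fun _ => sup_norm f) (norm (lim_infty f : C_NormedModule)) (sup_norm f));
      [|exact H|apply filterlim_const].
    exists 0. intros t Ht. apply (proj1 (sup_norm_spec f) t). lra.
Qed.

(** The mean over [0, t] splits at m: the initial piece contributes at most m A / t, and beyond m
    the values of f are within eps / 2 of the limit. *)
Lemma lim_infty_cesaro (f : Cinf) : lim_infty (cesaro f) = lim_infty f.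
Proof.
  apply lim_infty_unique. assert (Hl := lim_infty_spec f). set (l := lim_infty f) in *.
  destruct (Cinf_bounded (minus f (Cinf_const l))) as [A HA].
  assert (HA0 : 0 <= A) by (eapply Rle_trans; [apply Cmod_ge_0|apply (HA 0); lra]).
  apply filterlim_Cmod; [apply Rbar_locally_filter|]. intros eps He.
  apply filterlim_Cmod with (eps := eps / 2) in Hl; [|apply Rbar_locally_filter|lra].
  destruct Hl as [M HM]. set (m := Rmax 0 M + 1).
  assert (H1 := Rmax_l 0 M). assert (H2 := Rmax_r 0 M).
  assert (Hm : 0 < m) by (unfold m; lra).
  (* The first summand puts t beyond m, the second makes m A / t smaller than eps / 2. *)
  exists (m + m * A / (eps / 2)). intros t Ht.
  assert (H3 : 0 <= m * A / (eps / 2)).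
  { apply Rdiv_le_0_compat; [apply Rmult_le_pos; lra|lra]. }
  change (Cmod (cesaro_fun f t - l) < eps).
  eapply Rle_lt_trans.
  { apply (cesaro_dist f l m t A (eps / 2)); try lra; intros s Hs.
    - specialize (HA s (proj1 Hs)). now rewrite Cinf_minus_val in HA.
    - left. apply HM. unfold m in Hs. lra. }
  assert (H4 : m * A < t * (eps / 2)).
  { replace (m * A) with (m * A / (eps / 2) * (eps / 2)) by (field; lra).
    apply Rmult_lt_compat_r; lra. }
  assert (H5 : 0 <= m * (eps / 2)) by (apply Rmult_le_pos; lra).
  apply Rmult_lt_reg_r with t; [lra|].
  unfold Rdiv at 1. rewrite Rmult_assoc, Rinv_l by lra. lra.
Qed.

Lemma weak_limit_unique_value (u : nat -> Cinf) (v : Cinf) (phi : Cinf -> C) (c : C) :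
  filterlim (fun n => phi (u n)) eventually (locally (phi v)) ->
  (forall n, phi (u n) = c) -> phi v = c.
Proof.
  intros H Hc.
  apply (filterlim_locally_unique (V := C_NormedModule) (F := eventually)
    (fun n => phi (u n))); [exact H|].
  apply (filterlim_ext (fun _ => c)); [now intros n|apply filterlim_const].
Qed.

Lemma weak_cv_lim_infty (f : Cinf) :
  converges_weakly (V := Cinf_NormedModule) (fun n => Nat.iter n cesaro f) ->
  filterlim f (Rbar_locally p_infty) (locally (f 0)).
Proof.
  intros [v Hv].
  assert (Hfix : cesaro v = v).
  { apply Cinf_eq. intros t Ht.
    (* The sequence (T^(n+1) f)(t) has two limits: (Tv)(t), through the bounded functional sending w
       to (Tw)(t), and v t, as a shift of the evaluations at t. *)
    apply (filterlim_locally_unique (V := C_NormedModule) (F := eventually)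
      (fun n => Nat.iter (S n) cesaro f t)).
    - exact (Hv (fun w => cesaro w t)
        (is_linear_comp (U := Cinf_NormedModule) (V := Cinf_NormedModule)
           (W := C_NormedModule) _ _ (is_linear_iter_cesaro 1) (is_linear_eval t Ht))).
    - apply (filterlim_comp _ _ _ S (fun n => Nat.iter n cesaro f t) _ eventually).
      + apply eventually_subseq. intros n. constructor.
      + exact (Hv (fun w => w t) (is_linear_eval t Ht)). }
  assert (H0 : v 0 = f 0).
  { apply (weak_limit_unique_value (fun n => Nat.iter n cesaro f) v (fun w => w 0)).
    - exact (Hv _ (is_linear_eval 0 (Rle_refl 0))).
    - intros n. apply iter_cesaro_0. }
  assert (Hl : lim_infty v = lim_infty f).
  { apply (weak_limit_unique_value (fun n => Nat.iter n cesaro f) v lim_infty).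
    - exact (Hv _ is_linear_lim_infty).
    - intros n. induction n as [|n IH]; [reflexivity|].
      change (lim_infty (cesaro (Nat.iter n cesaro f)) = lim_infty f).
      now rewrite lim_infty_cesaro. }
  assert (Hc : lim_infty v = v 0).
  { apply lim_infty_unique. apply (filterlim_ext_loc (fun _ => v 0));
      [|apply filterlim_const].
    exists 0. intros t Ht. symmetry. apply cesaro_fixed_const; [exact Hfix|lra]. }
  (* The chain is f 0 = v 0 = lim v = lim f, whose middle equality uses that v is constant. *)
  rewrite <- H0, <- Hc, Hl. apply lim_infty_spec.
Qed.

Lemma norm_cv_weak_cv {V : NormedModule C_AbsRing} (u : nat -> V) :
  converges_in_norm u -> converges_weakly u.
Proof.
  intros [v Hv]. exists v. intros phi Hphi.
  apply filterlim_Cmod; [apply eventually_filter|]. intros eps He.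
  destruct (linear_norm phi Hphi) as [M [HM Hle]].
  assert (HeM : 0 < eps / M) by now apply Rdiv_lt_0_compat.
  generalize (proj2 (is_lim_seq_spec _ _) Hv (mkposreal _ HeM)).
  apply filter_imp. intros n Hn. simpl in Hn.
  rewrite Rminus_0_r, Rabs_pos_eq in Hn by apply norm_ge_0.
  assert (H := Hle (minus (u n) v)). rewrite (linear_minus phi _ _ Hphi) in H.
  change (Cmod (phi (u n) - phi v) <= M * norm (minus (u n) v)) in H.
  eapply Rle_lt_trans; [exact H|].
  apply Rmult_lt_compat_l with (r := M) in Hn; [|exact HM].
  replace (M * (eps / M)) with eps in Hn by (field; lra). exact Hn.
Qed.

Theorem theorem4p4 :
  (forall f : Cinf,
     let i := filterlim f (Rbar_locally p_infty) (locally (f 0)) in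
     let ii := converges_weakly (fun n => Nat.iter n cesaro f) in
     let iii := converges_in_norm (fun n => Nat.iter n cesaro f) in
     (i <-> ii) /\ (ii <-> iii) /\
     (i -> is_lim_seq (fun n => norm (minus (Nat.iter n cesaro f) (Pinit f))) 0)) /\
  (forall f : Cinf,
     filterlim f (Rbar_locally p_infty) (locally (f 0)) ->
     improper_RInt_exists (fun t => (f t - f 0) / RtoC t)%C ->
     exists K : R,
       eventually (fun n => norm (minus (Nat.iter n cesaro f) (Pinit f)) <= K / sqrt (INR n))).
Proof.
  split.
  - intros f i ii iii.
    assert (H3 : i -> iii) by (intros Hi; exists (Pinit f); now apply iter_cesaro_cv).
    assert (H32 : iii -> ii) by apply norm_cv_weak_cv.
    assert (H21 : ii -> i) by apply weak_cv_lim_infty.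
    split; [|split]; [tauto|tauto|]. apply iter_cesaro_cv.
  - intros f Hf HI. destruct (improper_cesaro_preimage (minus f (Pinit f))) as [g Hg].
    + apply minus_Pinit_at_0.
    + replace (fun t => minus f (Pinit f) t / RtoC t)%C
        with (fun t => (f t - f 0) / RtoC t)%C; [exact HI|].
      apply FunctionalExtensionality.functional_extensionality. intros t.
      now rewrite Cinf_minus_val.
    (* The constant is the norm of a preimage of f - Pf under I - T; the bound starts at n = 1
       because [iter_cesaro_rate] requires n positive. *)
    + exists (sup_norm g). exists 1%nat. intros n Hn.
      change (sup_norm (minus (Nat.iter n cesaro f) (Pinit f)) <= sup_norm g / sqrt (INR n)).
      rewrite iter_cesaro_minus_Pinit. apply (proj2 (sup_norm_spec _)).
      intros t Ht. now apply iter_cesaro_rate.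
Qed.
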